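(* Let $s \ge 1$ be an integer. If $G$ is an outerplanar graph, then $\mathrm{HG}_s(G) \le \bigl(3(s+1)^6 + 3(s+1)^3 + 3\bigr)^{3((s+1)^6+(s+1)^3+1)^2}$.
   Context: All graphs are finite and simple. For an integer $s\ge1$, $\mathrm{HG}_s(G)$ is the maximum $k$ such that, with color set $\{1,\dots,k\}$, there is a strategy (each vertex $v$ has a function mapping each coloring of its neighborhood $N(v)$ to a set of at most $s$ colors) such that for every coloring $\phi:V(G)\to\{1,\dots,k\}$ some vertex $v$ has $\phi(v)$ in the set its function assigns to $\phi|_{N(v)}$. *)

(* Defs.v *)
From HB Require Import structures.
From mathcomp Require Import all_boot all_order all_algebra.
From mathcomp Require Import all_classical all_reals all_analysis.
Import numFieldNormedType.Exports.

Set Implicit Arguments.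
Unset Strict Implicit.
Unset Printing Implicit Defensive.

Import Order.TTheory GRing.Theory Num.Theory.

Record sgraph := SGraph {
  vertex :> finType;
  adj : rel vertex;
  adj_sym : symmetric adj;
  adj_irrefl : irreflexive adj }.

Section HatGuessing.
Variables (G : sgraph) (s : nat).

Definition nbr (v : G) := {u : G | adj v u}.

Definition restrict k (phi : {ffun G -> 'I_k}) (v : G) : {ffun nbr v -> 'I_k} :=
  [ffun u => phi (val u)].

Definition strategy k := forall v : G, {ffun nbr v -> 'I_k} -> {set 'I_k}.

Definition s_guessing k (F : strategy k) :=
  forall (v : G) (c : {ffun nbr v -> 'I_k}), #|F v c| <= s.

Definition wins k (F : strategy k) :=
  forall phi : {ffun G -> 'I_k}, exists v : G, phi v \in F v (restrict phi v).

Definition winnable k := exists F : strategy k, s_guessing F /\ wins F.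

(* The largest k for which G is winnable.  The range k <= s * #|G| loses
   nothing by [winnable_bound]; see [HG_max] and [HG_winnable].  The graph
   without vertices is not winnable for any k and gets the value 0. *)
Definition HG : nat := \max_(k < (s * #|G|).+1 | `[< winnable k >]) k.

Lemma winnable_bound k : winnable k -> k <= s * #|G|.
Proof.
case: k => [//|k] [F [Fs Fw]].
pose C := {ffun G -> 'I_k.+1}.
pose A v := [pred phi : C | phi v \in F v (restrict phi v)].
pose upd (v : G) (p : C * 'I_k.+1) : C * 'I_k.+1 :=
  ([ffun u => if u == v then p.2 else p.1 u], p.1 v).
have updK v : involutive (upd v).
  move=> [phi c]; rewrite /upd /= ffunE eqxx; congr (_, _).
  by apply/ffunP => u; rewrite !ffunE /=; case: eqP => [->|].
have restr_upd v p : restrict (upd v p).1 v = restrict p.1 v.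
  apply/ffunP => u; rewrite !ffunE /=; case: eqP => // uv.
  by have := valP u; rewrite /= uv adj_irrefl.
have cardA v : k.+1 * #|A v| <= s * #|{: C}|.
  have -> : k.+1 * #|A v| = \sum_(p : C * 'I_k.+1) (A v p.1 : nat).
    rewrite -(pair_bigA _ (fun phi (_ : 'I_k.+1) => (A v phi : nat))) /=.
    under eq_bigr => phi _ do rewrite sum_nat_const card_ord.
    by rewrite -big_distrr /= -big_mkcond /= sum1_card.
  rewrite (reindex_inj (inv_inj (updK v))) /=.
  under eq_bigr => p _ do rewrite restr_upd /= ffunE eqxx.
  rewrite -(pair_bigA _ (fun phi c => (c \in F v (restrict phi v) : nat))) /=.
  rewrite mulnC -sum_nat_const; apply: leq_sum => phi _.
  by rewrite -big_mkcond /= sum1_card.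
have C_gt0 : 0 < #|{: C}| by apply/card_gt0P; exists [ffun=> ord0].
have cover : #|{: C}| <= \sum_v #|A v|.
  under eq_bigr => v _ do rewrite -sum1_card big_mkcond.
  rewrite exchange_big /= -sum1_card; apply: leq_sum => phi _.
  by have [v phiv] := Fw phi; rewrite (bigD1 v) //= inE phiv.
rewrite -(leq_pmul2r C_gt0).
apply: (leq_trans (leq_mul (leqnn k.+1) cover)).
rewrite big_distrr /= mulnAC mulnC -sum_nat_const.
by apply: leq_sum => v _; apply: cardA.
Qed.

Lemma HG_max k : winnable k -> k <= HG.
Proof.
move=> wk; have kb : k < (s * #|G|).+1 by rewrite ltnS winnable_bound.
by apply: (bigop.bigmax_sup (Ordinal kb)) => //; apply/asboolP.
Qed.

Lemma HG_winnable : 0 < #|G| -> winnable HG.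
Proof.
case/card_gt0P => v0 _.
have w0 : winnable 0.
  by exists (fun _ _ => finset.set0); split=> [v c|phi];
     [rewrite cards0 | case: (phi v0)].
rewrite /HG; elim/big_ind: _ => // [x y wx wy|k /asboolP //].
by rewrite /maxn; case: ifP.
Qed.

End HatGuessing.

Section Drawing.
Local Open Scope classical_set_scope.
Local Open Scope ring_scope.
Variables (R : realType) (G : sgraph).
Implicit Types (pos : G -> R * R) (arc : G -> G -> R -> R * R).

(* A drawing of G in the plane without crossings: [arc u v] parametrises on
   [0, 1], from u to v, the Jordan arc representing the edge uv; [arc u v] and
   [arc v u] have the same image, and are irrelevant when u, v are not
   adjacent. *)
Record plane_drawing pos arc : Prop := PlaneDrawing {
  pos_inj : injective pos;
  arc_cont : forall u v, adj u v -> {within `[0, 1], continuous (arc u v)};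
  arc_inj : forall u v, adj u v -> {in `[0, 1] &, injective (arc u v)};
  arc_src : forall u v, adj u v -> arc u v 0 = pos u;
  arc_tgt : forall u v, adj u v -> arc u v 1 = pos v;
  arc_rev : forall u v, adj u v -> arc v u @` `[0, 1] = arc u v @` `[0, 1];
  arc_vertex : forall u v w, adj u v -> ~ (arc u v @` `]0, 1[) (pos w);
  arc_disjoint : forall u v x y, adj u v -> adj x y ->
    ~ (u = x /\ v = y) -> ~ (u = y /\ v = x) ->
    arc u v @` `]0, 1[ `&` arc x y @` `]0, 1[ = set0 }.

Definition drawing_points pos arc : set (R * R) :=
  range pos `|` [set z | exists u v, adj u v /\ (arc u v @` `[0, 1]) z].

Definition face pos arc (F : set (R * R)) :=
  exists2 x, (~` drawing_points pos arc) x &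
    F = connected_component (~` drawing_points pos arc) x.

Definition outer_face pos arc (F : set (R * R)) :=
  face pos arc F /\ ~ bounded_set F.

(* Faces are open and contain no vertex, so a vertex is on the boundary of a
   face iff it is in its closure. *)
Definition outerplanar := exists pos arc, plane_drawing pos arc /\
  exists2 F, outer_face pos arc F & forall v, closure F (pos v).

End Drawing.

(* Main.v *)
(* A plane drawing with all vertices on one face yields no vertex y and connected
   set R with three common neighbours outside R: adding a point of that face
   would give a drawing of K_{3,3} in which independent edges are disjoint, which
   a mod 2 count of winding numbers excludes.

   Hence, in the distance levels from a root, every vertex has at most two
   neighbours in its own level and at most two in the previous one, and at most
   two of its children w are adjacent to some vertex of the two levels that is
   neither y itself nor a child of y.  These exceptional children form a set B
   meeting every neighbourhood in at most six vertices.  The players of B are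
   beaten already on a bounded palette, so it remains to beat the players outside
   B when each of them makes a bounded number s' of guesses, one batch for every
   colouring of its neighbours in B.  Outside B the levels collapse one after the
   other: a vertex whose children are coloured last acts as if it were guessing
   at most s' colours by itself, because s' + 1 candidate colours can be served
   by a single colouring of the children.  Both steps only need the hat game on
   graphs of bounded degree, which is lost by a Rosenfeld-style counting
   argument. *)
Require Import Defs.
From mathcomp Require Import all_boot.
From mathcomp Require Import zify.

Set Implicit Arguments.
Unset Strict Implicit.
Unset Printing Implicit Defensive.

(** * The hat game on induced subgraphs *)

Section Hat.
Variable G : sgraph.
Implicit Types (U A B W X : {set G}).

(* The game on the subgraph induced by [U]: guesses take total colourings, but
   may only read the colours of neighbours in [U]. *)
Definition local_on U k (F : G -> {ffun G -> 'I_k} -> {set 'I_k}) :=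
  forall v (phi psi : {ffun G -> 'I_k}), v \in U ->
    (forall u, u \in U -> adj v u -> phi u = psi u) -> F v phi = F v psi.

Definition avoidable U s k :=
  forall F : G -> {ffun G -> 'I_k} -> {set 'I_k},
    local_on U F -> (forall v phi, v \in U -> #|F v phi| <= s) ->
    exists phi : {ffun G -> 'I_k}, forall v, v \in U -> phi v \notin F v phi.

(** * Counting good colourings in bounded degree *)

Section BoundedDegree.
Variables (U : {set G}) (d s k : nat) (F : G -> {ffun G -> 'I_k} -> {set 'I_k}).
Hypotheses (Floc : local_on U F) (Fs : forall v phi, v \in U -> #|F v phi| <= s).
Hypothesis degU : forall v, v \in U -> #|[set u in U | adj v u]| <= d.
Hypothesis k_gt0 : 0 < k.
Hypothesis k_big : s * 2 ^ d.+1 <= k.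

Let good W := [set phi : {ffun G -> 'I_k} | [forall v in W, phi v \notin F v phi]].

(** Swapping the colour of [v] with a spare colour is an involution, hence a bijection on pairs
    suited to double counting. *)
Let recolour (v : G) (p : {ffun G -> 'I_k} * 'I_k) : {ffun G -> 'I_k} * 'I_k :=
  ([ffun u => if u == v then p.2 else p.1 u], p.1 v).

Let recolourK v : involutive (recolour v).
Proof.
move=> [phi c]; rewrite /recolour /= ffunE eqxx; congr (_, _).
by apply/ffunP => u; rewrite !ffunE /=; case: eqP => [->|].
Qed.

(** Neither membership in [good W] nor the guess of [v] depends on the colour of [v], because [W]
    avoids [v] and its neighbours. If that colour is redrawn among all [k], at most [s] choices hit
    the guess. *)
Lemma good_resample W v : W \subset U -> v \in U -> v \notin W ->
  (forall w, w \in W -> ~~ adj v w) ->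
  k * #|[set phi in good W | phi v \in F v phi]| <= s * #|good W|.
Proof.
move=> /subsetP WU vU vW nvW.
set bad := [set phi in _ | _].
have [Fr gr] : (forall p, F v (recolour v p).1 = F v p.1) /\
    (forall p, (p.1 \in good W) -> ((recolour v p).1 \in good W)).
  split=> [p|p].
    apply: Floc => // u _ vu; rewrite ffunE; case: eqP => // uv.
    by rewrite uv adj_irrefl in vu.
  rewrite !inE => /forall_inP gp; apply/forall_inP => w wW.
  have wv : w != v by apply: contraNneq vW => <-.
  rewrite ffunE (negbTE wv); have -> // : F w (recolour v p).1 = F w p.1; last exact: gp.
  apply: Floc => [|u _ wu]; first exact: WU.
  rewrite ffunE; case: eqP => // uv.
  by have := nvW _ wW; rewrite adj_sym -uv wu.
pose T := [set p : {ffun G -> 'I_k} * 'I_k | (p.1 \in good W) && (p.2 \in F v p.1)].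
have -> : k * #|bad| = #|setX bad [set: 'I_k]| by rewrite cardsX cardsT card_ord mulnC.
have cT : #|T| <= s * #|good W|.
  have -> : #|T| = \sum_(p in good W) #|F v p|.
    rewrite -sum1_card; under [RHS]eq_bigr do rewrite -sum1_card.
    by rewrite pair_big_dep /=; apply: eq_bigl => p; rewrite inE.
  by rewrite mulnC -sum_nat_const; apply: leq_sum => p _; apply: Fs.
apply: leq_trans cT.
rewrite -(card_imset (setX bad [set: 'I_k]) (inv_inj (recolourK v))); apply: subset_leq_card.
apply/subsetP => q /imsetP[p + ->]; rewrite !inE andbT => /andP[gp Fp].
by rewrite Fr /= Fp andbT; have := gr p; rewrite !inE; apply.
Qed.

(* Releasing one vertex from the obligation to guess wrong at most doubles the
   number of good colourings: a colouring lost on [v] is good away from the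
   neighbours of [v], and there the colour of [v] is free. *)
Lemma good_remove n W X : W \subset U -> #|W| <= n ->
  #|good (W :\: X)| <= 2 ^ #|X| * #|good W|.
Proof.
elim: n W X => [|n IHn] W X WU.
  rewrite leqn0 cards_eq0 => /eqP->.
  by rewrite set0D leq_pmull // expn_gt0.
move=> Wn.
have step W' v : W' \subset U -> #|W'| <= n.+1 -> #|good (W' :\ v)| <= 2 * #|good W'|.
  move=> W'U W'n; have [vW'|vW'] := boolP (v \in W'); last first.
    by rewrite (setDidPl _) ?leq_pmull // disjoint_sym disjoints1.
  have vU : v \in U by apply: (subsetP W'U).
  pose N := [set u in U | adj v u].
  pose bad := [set phi in good (W' :\ v) | phi v \in F v phi].
  have W1U : W' :\ v \subset U by apply: subset_trans W'U; apply: subsetDl.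
  have W1n : #|W' :\ v| <= n by move: W'n; rewrite (cardsD1 v) vW'.
  have gE : #|good (W' :\ v)| <= #|good W'| + #|bad|.
    apply: leq_trans (leq_card_setU _ _).
    apply: subset_leq_card; apply/subsetP => phi; rewrite !inE => gphi.
    rewrite gphi /=; have [|nF] := boolP (_ \in F v _); first by rewrite orbT.
    rewrite orbF; apply/forall_inP => w wW'; have [->//|wv] := eqVneq w v.
    by apply: (forall_inP gphi); rewrite !inE wv.
  (* The neighbours [N] of [v] are released as well, so that [good_resample] applies. The induction
     hypothesis on [W' :\ v] bounds the price by [2 ^ d], and [k_big] then makes [bad] at most half
     of [good (W' :\ v)]. *)
  pose W2 := (W' :\ v) :\: N.
  have W2U : W2 \subset U by apply: subset_trans W1U; apply: subsetDl.
  have b2 : #|bad| <= #|[set phi in good W2 | phi v \in F v phi]|.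
    apply: subset_leq_card; apply/subsetP => phi; rewrite !inE => /andP[gphi ->].
    rewrite andbT; apply/forall_inP => w; rewrite inE => /andP[_ wW].
    exact: (forall_inP gphi).
  have := @good_resample W2 v W2U vU; rewrite !inE eqxx andbF => /(_ isT) b1.
  have {}b1 : k * #|[set phi in good W2 | phi v \in F v phi]| <= s * #|good W2|.
    apply: b1 => w; rewrite !inE => /andP[+ /andP[_ wW']].
    by rewrite (subsetP W'U).
  have g2 := IHn (W' :\ v) N W1U W1n.
  have g3 : #|good W2| <= 2 ^ d * #|good (W' :\ v)|.
    by apply: leq_trans g2 _; rewrite leq_mul2r leq_exp2l // degU // orbT.
  have : k * (2 * #|bad|) <= k * #|good (W' :\ v)|.
    rewrite mulnCA; apply: leq_trans (leq_mul k_big (leqnn _)).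
    rewrite expnS [s * (2 * _)]mulnCA -!mulnA leq_mul2l /=.
    by apply: leq_trans (leq_mul (leqnn s) g3); apply: leq_trans b1; rewrite leq_mul2l b2 orbT.
  by rewrite leq_pmul2l // => ?; lia.
have [m Xm] := ubnP #|X|; elim: m => // m IHm in X Xm *.
have [->|[x xX]] := set_0Vmem X; first by rewrite setD0 cards0 mul1n.
have -> : W :\: X = (W :\: (X :\ x)) :\ x.
  apply/setP => u; rewrite !inE; case: (eqVneq u x) => [->|] //=; rewrite ?xX //.
apply: leq_trans (step _ _ _ _) _.
- by apply: subset_trans WU; apply: subsetDl.
- by apply: leq_trans Wn; apply: subset_leq_card; apply: subsetDl.
have := IHm (X :\ x); rewrite [#|X|](cardsD1 x) xX expnS -mulnA leq_mul2l /=.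
by apply; move: Xm; rewrite (cardsD1 x) xX.
Qed.

(** With [W] and [X] both equal to [U], [good_remove] compares [good U] with the set of all
    colourings, which is not empty. *)
Lemma good_exists : exists phi : {ffun G -> 'I_k}, forall v, v \in U -> phi v \notin F v phi.
Proof.
have := good_remove U (subxx _) (leqnn _); rewrite setDv.
have : 0 < #|good set0|.
  apply/card_gt0P; exists [ffun=> Ordinal k_gt0].
  by rewrite inE; apply/forall_inP => v; rewrite inE.
move=> g0 /(leq_trans g0); rewrite muln_gt0 => /andP[_ /card_gt0P[phi]].
by rewrite inE => /forall_inP phiP; exists phi.
Qed.

End BoundedDegree.

Lemma avoidable_degree U d s k : 0 < k ->
  (forall v, v \in U -> #|[set u in U | adj v u]| <= d) ->
  s * 2 ^ d.+1 <= k -> avoidable U s k.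
Proof. by move=> k0 dU kb F Fl Fs; apply: (@good_exists U d s k F). Qed.


(** * Colouring a graph piece by piece *)

Lemma leq_card_bigcup (I T : finType) (P : pred I) (F : I -> {set T}) m :
  (forall i, P i -> #|F i| <= m) -> #|\bigcup_(i | P i) F i| <= #|P| * m.
Proof.
move=> Fm; rewrite -sum_nat_const; elim/big_rec2: _ => [|i x X Pi IH].
  by rewrite cards0.
by apply: leq_trans (leq_card_setU _ _) _; apply: leq_add => //; apply: Fm.
Qed.

(** [A] is coloured first, each player facing the union of its guesses over the at most [l ^ d]
    colourings of its neighbours in [B]. Then [B] is coloured from the first [l] colours, and any
    outcome has been accounted for in [A]. *)
Lemma avoidableU A B d s l k : 0 < l -> l <= k -> [disjoint A & B] ->
  (forall v, v \in A -> #|[set u in B | adj v u]| <= d) ->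
  avoidable B s l -> avoidable A (s * l ^ d) k -> avoidable (A :|: B) s k.
Proof.
move=> l0 lk dAB dA avB avA F Fl Fs.
pose N v := [set u in B | adj v u].
pose emb : 'I_l -> 'I_k := widen_ord lk.
pose ext v (phi : {ffun G -> 'I_k}) (c : {ffun {u | u \in N v} -> 'I_l}) :=
  [ffun u => if insub u is Some x then emb (c x) else phi u].
have [||phiA phiAP] := avA (fun v phi => \bigcup_c F v (ext v phi c)).
- move=> v phi psi vA eqv; apply: eq_bigr => c _; apply: Fl => [|u].
    by rewrite inE vA.
  rewrite inE !ffunE; case: insubP => // uN uAB vu; apply: eqv => //.
  by case/orP: uAB => // uB; rewrite inE uB vu in uN.
- move=> v phi vA; apply: leq_trans (leq_card_bigcup (m := s) _) _.
    by move=> c _; apply: Fs; rewrite inE vA.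
  rewrite mulnC leq_mul2l; apply/orP; right; rewrite card_ffun card_ord card_sig.
  by rewrite leq_pexp2l // (leq_trans _ (dA _ vA)) // subset_leq_card //; apply/subsetP=> u; rewrite inE.
pose mix (psi : {ffun G -> 'I_l}) : {ffun G -> 'I_k} :=
  [ffun u => if u \in B then emb (psi u) else phiA u].
have embI : injective emb by move=> x y /(congr1 val) /= /val_inj.
have [||psi psiP] := avB (fun v psi => [set x | emb x \in F v (mix psi)]).
- move=> v psi psi' vB eqv; rewrite (_ : F v (mix psi) = F v (mix psi')) //.
  apply: Fl => [|u]; first by rewrite inE vB orbT.
  by rewrite !ffunE => _ vu; case: ifP => // uB; rewrite eqv.
- move=> v psi vB; apply: leq_trans (Fs v (mix psi) _); last by rewrite inE vB orbT.
  rewrite -(card_imset _ embI); apply: subset_leq_card.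
  by apply/subsetP => x /imsetP[y + ->]; rewrite inE.
exists (mix psi) => v; rewrite inE; have [vB _|vB] := boolP (v \in B).
  by have := psiP v vB; rewrite inE ffunE vB.
rewrite orbF => vA; rewrite ffunE (negbTE vB); apply: contra (phiAP v vA) => Fv.
apply/bigcupP; exists [ffun x => psi (val x)] => //; move: Fv.
rewrite (_ : F v (mix psi) = F v (ext v phiA [ffun x => psi (val x)])) //.
apply: Fl => [|u uAB vu]; first by rewrite inE vA.
rewrite [LHS]ffunE [RHS]ffunE; case: insubP => [x uN xu|]; last first.
  by rewrite inE vu andbT => /negbTE->.
by move: uN; rewrite inE ffunE xu => /andP[-> _].
Qed.

(** A guess reads only the player's own component, so colourings beating the components separately
    can be glued, the representative [root] selecting the one that applies. *)
Lemma avoidable_components s k :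
  (forall r, avoidable [set v | connect (@adj G) r v] s k) -> avoidable [set: G] s k.
Proof.
move=> av F Fl Fs.
have symG : connect_sym (@adj G) by apply: sym_connect_sym; apply: adj_sym.
have phiP r : exists phi : {ffun G -> 'I_k}, forall v, connect (@adj G) r v -> phi v \notin F v phi.
  have [||phi phiP] := av r F.
  - move=> v phi psi; rewrite inE => rv eqv; apply: Fl => // u _ vu.
    by apply: eqv => //; rewrite inE (connect_trans rv) ?connect1.
  - by move=> v phi _; apply: Fs.
  by exists phi => v rv; apply: phiP; rewrite inE.
have [Phi PhiP] := fin_all_exists phiP.
exists [ffun v => Phi (root (@adj G) v) v] => v _.
have := PhiP (root (@adj G) v) v; rewrite symG connect_root => /(_ isT).
rewrite ffunE (_ : F v (Phi _) = F v [ffun v => Phi (root (@adj G) v) v]) //.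
apply: Fl => // u _ vu; rewrite ffunE; congr (Phi _ u).
by apply/eqP; rewrite (root_connect symG) connect1.
Qed.

(* Level [n] is absorbed into level [n - 1]: [v] now guesses the colours that it
   guesses under every safe colouring of its children.  There are at most [s] of
   them, for [s + 1] such colours admit a common safe colouring of the children,
   under which the guess of [v] is a single set of size at most [s]. *)
Lemma avoidable_levels A (lev : G -> nat) d s k : 0 < k ->
  (forall u v, adj u v -> lev u <= (lev v).+1) ->
  (forall v, v \in A -> #|[set u in A | adj v u && (lev u == lev v)]| <= d) ->
  (forall v w u, v \in A -> w \in A -> u \in A -> adj v w -> lev w = (lev v).+1 ->
     adj w u -> lev v <= lev u <= lev w ->
     u = v \/ (lev u = lev w /\ adj v u)) ->
  s * s.+1 * 2 ^ d.+1 <= k -> avoidable A s k.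
Proof.
move=> k0 levA degA treeA kb.
have kbs : s * 2 ^ d.+1 <= k.
  by apply: leq_trans kb; rewrite leq_mul2r leq_pmulr ?orbT.
pose U n := [set v in A | lev v < n].
suff avU n : avoidable (U n) s k.
  have := avU (\max_v lev v).+1; congr avoidable.
  by apply/setP => v; rewrite inE ltnS (leq_bigmax v) andbT.
elim: n => [|n IHn] F Fl Fs.
  by exists [ffun=> Ordinal k0] => v; rewrite inE andbF.
pose L := [set v in A | lev v == n].
(* Written with a successor so that no vertex is [top] when [n] is 0. *)
pose top v := (v \in A) && ((lev v).+1 == n).
pose P v := [set w in L | adj v w].
(* The part of level [n] without neighbours in the level above it has no edges to the rest of
   [U n.+1], and is coloured on its own. *)
pose W := [set w in L | [forall v, top v ==> ~~ adj v w]].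
have LU : L \subset U n.+1 by apply/subsetP => v; rewrite !inE => /andP[-> /eqP->] /=.
have degL X : X \subset L -> forall v, v \in X -> #|[set u in X | adj v u]| <= d.
  move=> /subsetP XL v vX; have := XL v vX; rewrite inE => /andP[vA vn].
  apply: leq_trans (degA v vA); apply: subset_leq_card; apply/subsetP => u.
  by rewrite !inE => /andP[/XL]; rewrite inE (eqP vn) => /andP[-> ->] ->.
have nbrL w u : w \in L -> u \in U n.+1 -> adj w u -> top u \/ u \in L.
  rewrite !inE => /andP[wA /eqP wn] /andP[uA un] wu; rewrite /top uA /=.
  have := levA _ _ wu; rewrite wn ltnS in un *.
  by move=> h; case: (ltngtP (lev u) n) un h => // ? _ h; [left; lia | right].
have topU v : top v -> v \in U n by rewrite inE => /andP[-> /eqP<-] /=.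
have topL v : top v -> v \notin L.
  by case/andP=> _ /eqP vn; rewrite inE -vn negb_and neq_ltn ltnSn orbT.
(* By [treeA] a family of children touches the rest only through its parent, so different families
   can be coloured independently. *)
have nbrP v w u : top v -> w \in P v -> u \in U n.+1 -> adj w u -> u = v \/ u \in P v.
  move=> /andP[vA /eqP vn]; rewrite inE => /andP[wL vw] uU wu.
  move: (wL); rewrite inE => /andP[wA /eqP wn].
  have lwv : lev w = (lev v).+1 by rewrite wn vn.
  have [uA luv] : u \in A /\ lev v <= lev u <= lev w.
    case: (nbrL w u wL uU wu) => [/andP[uA /eqP un]|].
      have -> : lev u = lev v by apply: succn_inj; rewrite un vn.
      by split=> //; rewrite leqnn lwv leqnSn.
    by rewrite inE => /andP[uA /eqP un]; rewrite un wn leqnn andbT -vn leqnSn.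
  have [->|[luw vu]] := treeA v w u vA wA uA vw lwv wu luv; [by left | right].
  by rewrite !inE uA vu luw wn eqxx.
have vP v w : top v -> w \in P v -> forall v', top v' -> adj v' w -> v' = v.
  move=> vt wP v' vt' vw'; have v'U : v' \in U n.+1.
    by have := topU v' vt'; rewrite !inE => /andP[-> /ltnW].
  case: (nbrP v w v' vt wP v'U); rewrite ?(adj_sym w) //.
  by rewrite inE (negbTE (topL v' vt')).
have nbrW w u : w \in W -> u \in U n.+1 -> adj w u -> u \in W.
  rewrite inE => /andP[wL /forallP wt] uU wu.
  case: (nbrL _ _ wL uU wu) => [ut|uL]; first by have := wt u; rewrite ut adj_sym wu.
  rewrite inE uL; apply/forallP => v; apply/implyP => vt; apply/negP => vu.
  have uP : u \in P v by rewrite inE uL.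
  case: (nbrP v u w vt uP); rewrite ?(adj_sym u) ?(subsetP LU) //.
    by move=> wv; rewrite wv (negbTE (topL v vt)) in wL.
  by rewrite inE => /andP[_ vw]; have := wt v; rewrite vt vw.
have WL : W \subset L by apply/subsetP => w; rewrite inE => /andP[].
have PL v : P v \subset L by apply/subsetP => w; rewrite inE => /andP[].
have [||psiW psiWP] := avoidable_degree k0 (degL W WL) kbs (F := F).
- move=> w phi psi wW eqw; apply: Fl => [|u uU wu]; first exact/(subsetP LU)/(subsetP WL).
  by apply: eqw => //; apply: nbrW wu.
- by move=> w phi; rewrite inE => /andP[wL _]; apply: Fs; apply: (subsetP LU).
pose upd v x (psi : {ffun G -> 'I_k}) : {ffun G -> 'I_k} :=
  [ffun u => if u == v then x else psi u].
pose mix v (phi psi : {ffun G -> 'I_k}) : {ffun G -> 'I_k} :=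
  [ffun u => if u \in P v then psi u else phi u].
pose safe v x (psi : {ffun G -> 'I_k}) := [forall w in P v, psi w \notin F w (upd v x psi)].
pose F' v (phi : {ffun G -> 'I_k}) := if top v
  then [set x | [forall psi, safe v x psi ==> (x \in F v (mix v phi psi))]]
  else F v phi.
have nbrU v u : v \in U n -> u \in U n.+1 -> adj v u -> u \in U n \/ top v /\ u \in P v.
  rewrite !inE /top => /andP[vA vn] /andP[uA un] vu; rewrite vA uA vu /= andbT.
  have := levA u v; rewrite adj_sym => /(_ vu) h.
  by have [?|?] : lev u < n \/ lev u = n by [lia]; [left|right; split; lia].
have UP v w : w \in U n -> (w \in P v) = false.
  by rewrite !inE => /andP[wA wn]; apply/negbTE; rewrite !negb_and; lia.
have [||phi phiP] := IHn F'.
- move=> v phi psi vU eqv; have vU1 : v \in U n.+1.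
    by move: vU; rewrite !inE => /andP[-> /ltnW].
  rewrite /F'; case: ifP => vt; last first.
    by apply: Fl => // u uU vu; case: (nbrU v u vU uU vu) => [?|[]]; [apply: eqv|rewrite vt].
  apply/setP => x; rewrite !inE; apply: eq_forallb => chi.
  rewrite (_ : F v (mix v phi chi) = F v (mix v psi chi)) //; apply: Fl => // u uU vu; rewrite !ffunE; case: ifP => // uP.
  by case: (nbrU v u vU uU vu) => [?|[_]]; [apply: eqv|rewrite uP].
- move=> v phi vU; have vU1 : v \in U n.+1.
    by move: vU; rewrite !inE => /andP[-> /ltnW].
  rewrite /F'; case: ifP => vt; last exact: Fs.
  set S := [set x | _]; rewrite leqNgt; apply/negP => sS.
  pose X := [set x in take s.+1 (enum S)].
  have cX : #|X| = s.+1.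
    by rewrite cardsE (card_uniqP _) ?take_uniq ?enum_uniq // size_takel // -cardE.
  (* Each child faces its guesses for all [s + 1] candidate colours of [v] together, whence the
     factor [s * s.+1] in the bound. *)
  have [||psi psiP] := avoidable_degree k0 (degL _ (PL v)) kb
     (F := fun w psi => \bigcup_(x in X) F w (upd v x psi)).
  - move=> w psi psi' wP eqw; apply: eq_bigr => x _; apply: Fl => [|u uU wu].
      by apply: (subsetP LU); move: wP; rewrite inE => /andP[].
    rewrite !ffunE; case: eqP => // uv; apply: eqw => //.
    by case: (nbrP v w u vt wP uU wu).
  - move=> w psi wP; rewrite mulnC -cX; apply: leq_card_bigcup => x _; apply: Fs.
    by apply: (subsetP LU); move: wP; rewrite inE => /andP[].
  have := Fs v (mix v phi psi) vU1; rewrite leqNgt => /negP; apply.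
  rewrite -cX; apply: subset_leq_card; apply/subsetP => x xX.
  have : x \in S by move: xX; rewrite inE => /mem_take; rewrite mem_enum.
  rewrite inE => /forallP/(_ psi)/implyP; apply; apply/forall_inP => w wP.
  by apply: contra (psiP w wP) => Fw; apply/bigcupP; exists x.
(* Since [phi v] lies outside [F' v phi], some safe colouring of the children makes [v] guess
   wrong. *)
have PsiE v : exists psi : {ffun G -> 'I_k},
    top v -> safe v (phi v) psi && (phi v \notin F v (mix v phi psi)).
  have [vt|] := boolP (top v); last by exists phi.
  have := phiP v; rewrite /F' vt !inE; case/andP: (vt) => -> /eqP vn.
  rewrite -vn leqnn => /(_ isT); rewrite negb_forall => /existsP[psi].
  by rewrite negb_imply => ?; exists psi.
have {PsiE} [Psi PsiP] := fin_all_exists PsiE.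
exists [ffun w => if w \in L then
   (if [pick v | top v && adj v w] is Some v then Psi v w else psiW w) else phi w].
set phis := [ffun w => _].
have phisL w : w \in U n -> phis w = phi w.
  by rewrite ffunE !inE => /andP[-> wn]; rewrite /= ifF //; lia.
have phisP v w : top v -> w \in P v -> phis w = Psi v w.
  move=> vt wP; have := wP; rewrite ffunE inE => /andP[-> vw].
  case: pickP => [v' /andP[vt' vw']|/(_ v)]; last by rewrite vt vw.
  by rewrite (vP v w vt wP v').
have phisW w : w \in W -> phis w = psiW w.
  rewrite ffunE inE => /andP[-> /forallP wt]; case: pickP => // v /andP[vt vw].
  by have := wt v; rewrite vt vw.
move=> x xU; have [xL|xL] := boolP (x \in L); last first.
  have xUn : x \in U n.
    by move: xU xL; rewrite !inE => /andP[-> ] /=; lia.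
  rewrite (phisL x xUn); have [xt|xt] := boolP (top x).
    have /andP[_] := PsiP x xt; rewrite (_ : F x (mix _ _ _) = F x phis) //.
    apply: Fl => // u uU xu; rewrite ffunE.
    case: (nbrU x u xUn uU xu) => [uUn|[_ uP]]; last by rewrite uP (phisP x).
    by rewrite UP // phisL.
  have := phiP x xUn; rewrite /F' (negbTE xt) (_ : F x phi = F x phis) //.
  apply: Fl => // u uU xu; rewrite phisL //.
  by case: (nbrU x u xUn uU xu) => // -[xt']; rewrite xt' in xt.
have [xW|] := boolP (x \in W).
  rewrite phisW //; have := psiWP x xW; rewrite (_ : F x psiW = F x phis) //.
  by apply: Fl => // u uU xu; rewrite phisW //; apply: nbrW xu.
rewrite inE xL negb_forall => /existsP[v]; rewrite negb_imply negbK => /andP[vt vx].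
have xP : x \in P v by rewrite inE xL.
rewrite (phisP v x vt xP).
have /andP[/forall_inP/(_ x xP)] := PsiP v vt.
rewrite (_ : F x (upd _ _ _) = F x phis) => [+ _ //|]; apply: Fl => // u uU xu.
rewrite ffunE; case: eqP => [->|uv].
  by rewrite phisL //; apply: topU.
by case: (nbrP v x u vt xP uU xu) => // uP; rewrite (phisP v u).
Qed.

End Hat.

(* No three common neighbours of a vertex [y] and a connected set [R]: a weak
   form of the absence of a K_{2,3} minor. *)
Definition no_K23 (G : sgraph) := forall (y : G) (R : {set G}), y \notin R ->
  (forall a b, a \in R -> b \in R ->
     connect [rel u v : G | [&& u \in R, v \in R & adj u v]] a b) ->
  #|[set w | [&& w \notin R, adj y w & [exists z in R, adj w z]]]| <= 2.

(** * Distance levels and exceptional children *)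

Section Levels.
Variable G : sgraph.

(** [lev] is the distance from [r]. Vertices of other components get level 0, which keeps the second
    clause valid for every edge, since no edge joins two components. *)
Lemma distance_exists (r : G) : exists lev : G -> nat,
  [/\ lev r = 0,
      (forall u v, adj u v -> lev u <= (lev v).+1) &
      (forall v, connect (@adj G) r v -> v <> r ->
         exists u, [/\ adj u v, lev v = (lev u).+1 & connect (@adj G) r u])].
Proof.
pose walk v n := exists t : seq G, [/\ path (@adj G) r t, last r t = v & size t = n].
have levP v : exists n, (connect (@adj G) r v -> walk v n /\ forall m, walk v m -> n <= m) /\
    (~~ connect (@adj G) r v -> n = 0).
  have [/connectP[t rt ->]|_] := boolP (connect (@adj G) r v); last by exists 0.
  have : exists n, walk (last r t) n by exists (size t), t.
  case=> n; have [k] := ubnP n; elim: k n => // k IH n nk wn.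
  have [[m [wm mn]]|nlt] := boolp.pselect (exists m, walk (last r t) m /\ m < n).
    by apply: IH wm; lia.
  exists n; split=> // _; split=> // m wm; rewrite leqNgt; apply/negP => mn.
  by apply: nlt; exists m.
have [lev {}levP] := fin_all_exists levP.
have lev_min v n : walk v n -> lev v <= n.
  move=> wv; have [[t [rt vt _]] h] := (wv, levP v).
  by case: h.1 => [|_]; [rewrite -vt; apply/connectP; exists t | apply].
have levW v : connect (@adj G) r v -> walk v (lev v) by case: (levP v) => h _ /h[].
exists lev; split.
- by apply/eqP; rewrite -leqn0; apply: lev_min; exists [::].
- move=> u v uv; have [rv|nrv] := boolP (connect (@adj G) r v).
    have [t [rt tv <-]] := levW v rv.
    apply: lev_min; exists (rcons t u); rewrite rcons_path last_rcons size_rcons.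
    by rewrite rt tv adj_sym uv.
  have [_ ->//] := levP u; apply: contra nrv => ru.
  by apply: connect_trans ru _; apply: connect1.
- move=> v rv vr; have [t] := levW v rv.
  case/lastP: t => [|t u] [rt tv st]; first by rewrite -tv in vr.
  move: rt tv st; rewrite rcons_path last_rcons size_rcons => /andP[rt tu] uv st.
  rewrite uv in tu; exists (last r t); have rl : connect (@adj G) r (last r t).
    by apply/connectP; exists t.
  split=> //; apply/eqP; rewrite eqn_leq; apply/andP; split.
    have [t' [rt' tv' <-]] := levW _ rl.
    apply: lev_min; exists (rcons t' v); rewrite rcons_path last_rcons size_rcons.
    by rewrite rt' tv' tu.
  by rewrite -st ltnS; apply: lev_min; exists t.
Qed.

Hypothesis K23 : no_K23 G.

(** The exponents come from degrees: at most 6 neighbours in [B] give the palette [s * 2 ^ (6 + 1)]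
    for [B] and up to [s * l ^ 6] guesses outside it; at most 2 neighbours in the same level give
    the factor [2 ^ (2 + 1)]. *)
Lemma avoidable_component (r : G) s l k : 0 < s -> l = s * 2 ^ 7 -> l <= k ->
  s * l ^ 6 * (s * l ^ 6).+1 * 2 ^ 3 <= k ->
  avoidable [set v | connect (@adj G) r v] s k.
Proof.
move=> s0 lE lk kb; have [lev [lev0 levA parent]] := distance_exists r.
set U := [set v | _].
have Uadj u v : u \in U -> adj u v -> v \in U.
  by rewrite !inE => ru uv; apply: connect_trans ru _; apply: connect1.
have rU : r \in U by rewrite inE connect0.
have parentU v : v \in U -> v != r -> exists2 u, u \in U & adj u v /\ lev v = (lev u).+1.
  by rewrite inE => rv /eqP vr; have [u [? ? ?]] := parent v rv vr; exists u; rewrite ?inE.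
have lev0r v : v \in U -> lev v = 0 -> v = r.
  by move=> vU v0; apply/eqP/negPn/negP => /(parentU v vU)[u _ []]; rewrite v0.
(* Following parents leads down to [r] without leaving [R]. *)
have conn (R : {set G}) : R \subset U -> r \in R ->
    (forall v, v \in R -> v != r -> exists2 u, u \in R & adj u v /\ lev v = (lev u).+1) ->
    forall a b, a \in R -> b \in R ->
      connect [rel u v : G | [&& u \in R, v \in R & adj u v]] a b.
  move=> RU rR par; set e := [rel u v | _].
  have eS : connect_sym e.
    by apply: sym_connect_sym => u v; rewrite /= adj_sym andbCA.
  have tor n a : lev a <= n -> a \in R -> connect e r a.
    elim: n a => [|n IH] a an aR; have [->|ar] := eqVneq a r; rewrite ?connect0 //.
      by case/eqP: ar; apply: (lev0r a (subsetP RU _ aR)); lia.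
    have [u uR [ua la]] := par a aR ar.
    apply: connect_trans (IH u _ uR) _; first by lia.
    by apply: connect1; rewrite /= uR aR.
  move=> a b aR bR; apply: (@connect_trans _ _ r); last exact: (tor (lev b)).
  by rewrite eS; apply: (tor (lev a)).
have connD n : 0 < n -> forall a b, a \in [set z in U | lev z < n] -> b \in [set z in U | lev z < n] ->
      connect [rel u v : G | [&& u \in [set z in U | lev z < n], v \in [set z in U | lev z < n] & adj u v]] a b.
  move=> n0; apply: conn; first by apply/subsetP => v; rewrite inE => /andP[].
    by rewrite inE rU lev0.
  move=> v; rewrite inE => /andP[vU vn] /(parentU v vU)[u uU [uv lv]].
  by exists u => //; rewrite inE uU; lia.
(* [no_K23] is applied to the union of the levels below [v], where every vertex of the same level
   has a parent. *)
have sib v : v \in U -> #|[set u | adj v u & lev u == lev v]| <= 2.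
  move=> vU; have [v0|vpos] := posnP (lev v).
    rewrite (_ : [set u | _] = set0) ?cards0 //; apply/setP => u; rewrite !inE.
    apply/negP => /andP[vu /eqP]; rewrite v0 => u0; move: (vu).
    by rewrite (lev0r u (Uadj _ _ vU vu) u0) (lev0r v vU v0) adj_irrefl.
  have := K23 (y := v) _ (connD _ vpos); rewrite inE ltnn andbF => /(_ isT).
  apply: leq_trans; apply: subset_leq_card; apply/subsetP => u; rewrite !inE.
  move=> /andP[vu /eqP lu]; rewrite lu ltnn andbF vu /=.
  have uU := Uadj _ _ vU vu; have [|z zU [zu lz]] := parentU u uU.
    by apply: contraTneq vpos => ur; rewrite -lu ur lev0.
  by apply/existsP; exists z; rewrite inE zU adj_sym zu andbT; lia.
(* Here the connected set stops one level lower, short of the parents of [v], which reach it through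
   their own parents. Up to level 1 the only possible parent is [r]. *)
have par v : v \in U -> #|[set u | adj v u & (lev u).+1 == lev v]| <= 2.
  move=> vU; have [v1|v2] := leqP (lev v) 1.
    apply: leq_trans (_ : #|[set r]| <= 2); last by rewrite cards1.
    apply: subset_leq_card; apply/subsetP => u; rewrite !inE => /andP[vu lu].
    by apply/eqP/lev0r; [apply: Uadj vu | lia].
  have v1 : 0 < (lev v).-1 by lia.
  have := K23 (y := v) _ (connD _ v1); rewrite inE negb_and -leqNgt leq_pred orbT => /(_ isT).
  apply: leq_trans; apply: subset_leq_card; apply/subsetP => u; rewrite !inE.
  move=> /andP[vu /eqP lu]; rewrite -lu ltnn andbF vu /=.
  have uU := Uadj _ _ vU vu; have [|z zU [zu lz]] := parentU u uU.
    by apply: contraTneq v2 => ur; rewrite -lu ur lev0.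
  by apply/existsP; exists z; rewrite inE zU adj_sym zu andbT; lia.
(* Removing [B] leaves a graph in which the children of a vertex [y] are joined,
   within the two levels concerned, only to [y] and to each other. *)
pose link y w := [&& adj y w, lev w == (lev y).+1 &
  [exists u, adj w u && (((u != y) && (lev u == lev y)) || ((lev u == lev w) && ~~ adj u y))]].
pose B := [set w in U | [exists y, link y w]].
have child v : v \in U -> #|[set w in B | adj v w & lev w == (lev v).+1]| <= 2.
  move=> vU.
  (* The levels up to that of [v], without [v], and the vertices of the next level not adjacent to
     [v]: every vertex other than [r] keeps a parent inside, and every exceptional child of [v] has
     a neighbour there. *)
  pose R := [set z in U | (z != v) && (lev z <= lev v) || (lev z == (lev v).+1) && ~~ adj z v].
  have inR w : w \in B -> adj v w -> lev w = (lev v).+1 -> exists2 z, z \in R & adj w z.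
    rewrite inE => /andP[wU /existsP[y /and3P[yw /eqP ly /existsP[u /andP[wu h]]]]] vw lv.
    have yU : y \in U by apply: (Uadj w); rewrite // adj_sym.
    have uU : u \in U by apply: (Uadj w).
    have [yv|yv] := eqVneq y v.
      rewrite yv lv in h; exists u => //; rewrite inE uU /=.
      by case/orP: h => /andP[] => [->|->] => [/eqP->|->]; rewrite ?leqnn ?orbT.
    have lyv : lev y = lev v by apply: succn_inj; rewrite -ly lv.
    by exists y; [rewrite inE yU yv lyv leqnn | rewrite adj_sym].
  (* For [v = r] the set [R] is empty, as all vertices of level 1 are adjacent to [r]. *)
  have [v0|vpos] := posnP (lev v).
    rewrite (_ : [set u in B | _] = set0) ?cards0 //; apply/setP => w; rewrite [RHS]inE inE.
    apply/negP => /and3P[wB vw /eqP lw]; have [z] := inR w wB vw lw.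
    have vr := lev0r v vU v0.
    rewrite inE v0 leqn0 => /andP[zU /orP[/andP[/eqP zv /eqP z0]|/andP[/eqP lz zv]]] _.
      by apply: zv; rewrite vr; apply: lev0r.
    have [|u uU [uz lu]] := parentU z zU; first by apply/eqP => zr; rewrite zr lev0 in lz.
    have ur : u = r by apply: lev0r => //; apply: succn_inj; rewrite -lu lz.
    by rewrite vr -ur adj_sym uz in zv.
  have vR : v \notin R by rewrite inE eqxx /= negb_and; lia.
  have cR : forall a b, a \in R -> b \in R ->
      connect [rel u v : G | [&& u \in R, v \in R & adj u v]] a b.
    apply: conn.
    - by apply/subsetP => z; rewrite inE => /andP[].
    - rewrite inE rU lev0 leq0n andbT; apply/orP; left.
      by apply: contraTneq vpos => <-; rewrite lev0.
    - move=> z; rewrite inE => /andP[zU hz] /(parentU z zU)[u uU [uz lz]].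
      exists u => //; rewrite inE uU /=; apply/orP; left; apply/andP; split; last by lia.
      apply/eqP => uv; move: hz; rewrite lz uv adj_sym -uv uz andbF orbF uv.
      by rewrite ltnn andbF.
  apply: leq_trans (K23 vR cR); apply: subset_leq_card; apply/subsetP => w.
  rewrite !inE => /andP[wB /andP[vw /eqP lw]].
  have [|z zR wz] := inR w _ vw lw; first by rewrite !inE.
  rewrite vw lw adj_sym vw /= andbF orbF ltnn andbF andbF /=.
  by apply/existsP; exists z; rewrite zR.
have degB v : v \in U -> #|[set u in B | adj v u]| <= 6.
  move=> vU; apply: leq_trans (leq_add (leq_add (child v vU) (sib v vU)) (par v vU)).
  apply: leq_trans (leq_add (leq_card_setU _ _) (leqnn _)).
  apply: leq_trans (leq_card_setU _ _); apply: subset_leq_card; apply/subsetP => u.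
  rewrite 2!inE => /andP[uB vu]; rewrite !inE vu /= -orbA.
  have := levA u v; rewrite adj_sym vu => /(_ isT).
  have := levA v u vu; move: uB; rewrite inE => ->; rewrite /= => h1 h2.
  by have [->|[->|->]] : lev u = (lev v).+1 \/ lev u = lev v \/ (lev u).+1 = lev v by [lia];
    rewrite ?eqxx ?orbT.
have BU : B \subset U by apply/subsetP => v; rewrite inE => /andP[].
have -> : U = (U :\: B) :|: B by rewrite setUC -{1}(setIidPr BU) setID.
apply: (@avoidableU _ _ _ 6 s l) => //.
- by rewrite lE muln_gt0 s0 expn_gt0.
- by rewrite disjoints_subset; apply/subsetP => v; rewrite !inE => /andP[].
- by move=> v; rewrite inE => /andP[_]; apply: degB.
- apply: (@avoidable_degree _ _ 6); last by rewrite lE.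
    by rewrite lE muln_gt0 s0 expn_gt0.
  by move=> v /(subsetP BU)/degB.
apply: (@avoidable_levels _ _ lev 2) => //.
- by apply: leq_trans lk; rewrite lE muln_gt0 s0 expn_gt0.
- move=> v; rewrite inE => /andP[_ vU]; apply: leq_trans (sib v vU).
  by apply: subset_leq_card; apply/subsetP => u; rewrite !inE => /andP[].
- move=> v w u; rewrite [v \in _]inE [w \in _]inE => /andP[_ vU] /andP[wB wU] uA vw lw wu.
  move=> /andP[vlu ulw]; have nl : ~~ link v w.
    by apply: contra wB => h; rewrite inE wU; apply/existsP; exists v.
  move: nl; rewrite /link vw lw eqxx /= negb_exists => /forallP/(_ u).
  rewrite wu /= negb_or !negb_and !negbK.
  have [lu|lu] : lev u = lev v \/ lev u = (lev v).+1
    by move: vlu ulw; rewrite lw; clear; lia.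
    by rewrite lu eqxx orbF => /andP[/eqP->]; left.
  by rewrite lu eqxx (adj_sym v) => /andP[_ /= ->]; right.
Qed.

Lemma no_K23_not_winnable s l k : 0 < s -> l = s * 2 ^ 7 -> l <= k ->
  s * l ^ 6 * (s * l ^ 6).+1 * 2 ^ 3 <= k -> ~ winnable G s k.
Proof.
move=> s0 lE lk kb [F [Fs Fw]].
have [||phi phiP] := avoidable_components (fun r => @avoidable_component r s l k s0 lE lk kb)
  (F := fun v phi => F v (restrict phi v)).
- move=> v phi psi _ eqv; congr (F v _); apply/ffunP => u; rewrite !ffunE.
  by apply: eqv; rewrite ?inE // (valP u).
- by move=> v phi _; apply: Fs.
by have [v] := Fw phi; apply/negP; apply: phiP; rewrite inE.
Qed.

End Levels.

From mathcomp Require Import all_boot all_order all_algebra.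
From mathcomp Require Import lra.
Import Order.TTheory GRing.Theory Num.Theory.

(** * Winding parities of polygonal chains *)

Section Crossings.
Local Open Scope ring_scope.
Variable R : realFieldType.
Implicit Types (a b c d u v x y : R * R) (p q : seq (R * R)).

Definition near_pt (e : R) a b := (`|a.1 - b.1| <= e) && (`|a.2 - b.2| <= e).

(** A half-open half-plane, containing exactly one of any two opposite non-zero vectors. *)
Definition upper d := (0 < d.2) || (d.2 == 0) && (0 < d.1).

(* Counts passages through the positive half-axis. *)
Definition crossing d d' := (upper d (+) upper d') && (0 < d.1).

(** For a closed chain [a :: p] with steps small compared to its distance from [v], this is the
    winding number around [v] modulo 2. *)
Fixpoint winding v a p : bool :=
  if p is b :: p' then crossing (a - v) (b - v) (+) winding v b p' else false.

Lemma near_ptP e a b :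
  near_pt e a b -> [/\ a.1 - b.1 <= e, b.1 - a.1 <= e, a.2 - b.2 <= e & b.2 - a.2 <= e].
Proof. by rewrite /near_pt !ler_norml => /andP[/andP[? ?] /andP[? ?]]; split; lra. Qed.

Lemma far_ptP e a b : ~~ near_pt e a b ->
  [\/ e < a.1 - b.1, e < b.1 - a.1, e < a.2 - b.2 | e < b.2 - a.2].
Proof.
rewrite /near_pt negb_and -!ltNge !lter_normr => /orP[] /orP[] ?;
  [constructor 1|constructor 2|constructor 3|constructor 4]; lra.
Qed.

Lemma near_pt_sym e a b : near_pt e a b = near_pt e b a.
Proof. by rewrite /near_pt !(distrC a.1) !(distrC a.2). Qed.

Lemma upper_pos d : 0 < d.2 -> upper d.
Proof. by rewrite /upper => ->. Qed.

Lemma upper_neg d : d.2 < 0 -> upper d = false.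
Proof. by rewrite /upper => h; rewrite lt_gtF // lt_eqF. Qed.

Lemma crossing_pos d d' : 0 < d.1 -> crossing d d' = upper d (+) upper d'.
Proof. by rewrite /crossing => ->; rewrite andbT. Qed.

Lemma crossing_neg d d' : d.1 < 0 -> crossing d d' = false.
Proof. by rewrite /crossing => h; rewrite lt_gtF // andbF. Qed.

Lemma upperN d : d != 0 -> upper (- d) = ~~ upper d.
Proof.
case: d => x y; rewrite /upper /= !oppr_cp0 oppr_eq0 => nz.
case: (ltgtP y 0) => //= y0; case: (ltgtP x 0) => //= x0.
by rewrite x0 y0 eqxx in nz.
Qed.

(* All four vectors [c - a] of a small cell lie in one open half-plane, left,
   right, lower or upper. *)
Lemma crossing_cell e a a' b b' : near_pt e a a' -> near_pt e b b' ->
  ~~ near_pt (2 * e) a b ->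
  crossing (b - a) (b' - a) (+) crossing (b - a') (b' - a') =
  crossing (b - a) (b - a') (+) crossing (b' - a) (b' - a').
Proof.
move=> /near_ptP[? ? ? ?] /near_ptP[? ? ? ?] /far_ptP[] ?.
- by rewrite !crossing_neg //=; lra.
- rewrite !crossing_pos /=; try lra.
  by do 4!case: (upper _).
- by rewrite /crossing !upper_neg //=; lra.
- by rewrite /crossing !upper_pos //=; lra.
Qed.

(** Negation turns passages through the positive half-axis into passages through the negative one,
    and both kinds together make up all changes of [upper]. *)
Lemma crossing_rev e a a' x : near_pt e a a' -> ~~ near_pt (2 * e) a x ->
  crossing (x - a) (x - a') =
  crossing (a - x) (a' - x) (+) (upper (a - x) (+) upper (a' - x)).
Proof.
move=> aa' ax; have [? ? ? ?] := near_ptP aa'.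
have ha : a - x != 0.
  by apply: contraNneq ax => /subr0_eq ->; rewrite /near_pt !subrr normr0 andbb; lra.
have ha' : a' - x != 0.
  apply: contraNneq ax => /subr0_eq <-.
  by case/andP: aa' => h1 h2; apply/andP; split; lra.
have -> : crossing (x - a) (x - a') =
    (upper (a - x) (+) upper (a' - x)) && (0 < (x - a).1).
  by rewrite -(opprB a x) -(opprB a' x) /crossing !upperN // addNb addbN negbK.
rewrite {}/crossing; case: (far_ptP ax) => ?.
- by rewrite [0 < (x - a).1]lt_gtF 1?[0 < (a - x).1](_ : _ = true) ?andbF ?andbT ?addbb //=; lra.
- by rewrite [0 < (a - x).1]lt_gtF 1?[0 < (x - a).1](_ : _ = true) ?andbF ?andbT //=; lra.
- by rewrite !upper_pos //=; lra.
- by rewrite !upper_neg //=; lra.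
Qed.

(** [crossing_cell] is summed along [q]; the contributions of inner points cancel in pairs. *)
Lemma winding_move e a a' b q : near_pt e a a' -> path (near_pt e) b q ->
  {in b :: q, forall c, ~~ near_pt (2 * e) a c} ->
  winding a b q (+) winding a' b q =
  crossing (b - a) (b - a') (+) crossing (last b q - a) (last b q - a').
Proof.
move=> aa'; elim: q b => [|b' q IHq] b /=; first by rewrite addbb.
move=> /andP[bb' pq] far; rewrite addbACA (crossing_cell aa' bb'); last first.
  by apply: far; rewrite mem_head.
rewrite IHq // => [|c cq]; last by apply: far; rewrite inE cq orbT.
by rewrite addbA addbK.
Qed.

(* The boundary of the square of differences [f t - e s], for [s, t] ranging over
   the two chains, winds trivially around 0. *)
Lemma winding_square e u p x q :
  path (near_pt e) u p -> path (near_pt e) x q ->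
  {in u :: p & x :: q, forall a c, ~~ near_pt (2 * e) a c} ->
  let v := last u p in let y := last x q in
  winding u x q (+) winding v x q =
  (winding x u p (+) winding y u p) (+)
  ((upper (u - x) (+) upper (v - x)) (+) (upper (u - y) (+) upper (v - y))).
Proof.
move=> + pq; elim: p u => [|u' p IHp] u /=; first by rewrite !addbb.
move=> /andP[uu' pp] far.
have yq : last x q \in x :: q by rewrite mem_last.
have far' : {in u' :: p & x :: q, forall a c, ~~ near_pt (2 * e) a c}.
  by move=> a c ap; apply: far; rewrite inE ap orbT.
have := winding_move uu' pq (fun c cq => far u c (mem_head _ _) cq).
rewrite (crossing_rev uu' (far u x (mem_head _ _) (mem_head _ _))).
rewrite (crossing_rev uu' (far u _ (mem_head _ _) yq)) => mv.
rewrite -[winding u x q](addbK (winding u' x q)) mv -addbA (IHp u' pp far').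
set y := last x q; set v := last u' p.
move: (winding x u' p) (winding y u' p) (upper (v - x)) (upper (v - y)).
move: (crossing (u - x) (u' - x)) (crossing (u - y) (u' - y)).
move: (upper (u - x)) (upper (u' - x)) (upper (u - y)) (upper (u' - y)).
by do 10!case.
Qed.

(** Over the six pairs every [P l] and every [Q j] occurs twice and cancels, while [D j l] and
    [D l j] add up to 1 for each of the three unordered pairs, which leaves an odd total. *)
Lemma xor_offdiagonal (P Q : 'I_3 -> bool) (D M M' : 'I_3 -> 'I_3 -> bool) :
  (forall j l, j != l -> D l j = ~~ D j l) ->
  (forall j l, j != l -> M j l (+) M' l j = P l (+) Q j (+) D j l) ->
  let sum N := N 0 1 (+) N 0 2 (+) N 1 0 (+) N 1 2 (+) N 2 0 (+) N 2 1 in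
  sum M = ~~ sum M'.
Proof.
move=> Dsym MM' /=.
pose c j l := P l (+) Q j (+) D j l.
have ME j l : j != l -> M j l = c j l (+) M' l j by move=> jl; rewrite /c -MM' // addbK.
have cE : c 2 1 = ~~ (c 0 1 (+) c 0 2 (+) c 1 0 (+) c 1 2 (+) c 2 0).
  rewrite /c (Dsym 0 1) // (Dsym 0 2) // (Dsym 1 2) //.
  by move: (P 0) (P 1) (P 2) (Q 0) (Q 1) (Q 2) (D 0 1) (D 0 2) (D 1 2); do 9!case.
rewrite !ME // cE; move: (c 0 1) (c 0 2) (c 1 0) (c 1 2) (c 2 0).
by move: (M' 0 1) (M' 0 2) (M' 1 0) (M' 1 2) (M' 2 0) (M' 2 1); do 11!case.
Qed.

(* Strong Hanani-Tutte for K_{3,3}: by [winding_square], summed over the six pairs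
   [j != l], the winding parities [m i] attached to the three points [a i] would
   be pairwise distinct. *)
Lemma no_K33_chains e (a b : 'I_3 -> R * R) (g : 'I_3 -> 'I_3 -> seq (R * R)) :
  0 <= e ->
  (forall i j, path (near_pt e) (a i) (g i j) /\ last (a i) (g i j) = b j) ->
  (forall i j k l, i != k -> j != l ->
     {in a i :: g i j & a k :: g k l, forall x y, ~~ near_pt (2 * e) x y}) ->
  False.
Proof.
move=> e0 gP far.
have bb j l : j != l -> b j - b l != 0.
  move=> jl; have [[_ e1] [_ e2]] := (gP 0 j, gP 1 l).
  have := far 0 j 1 l isT jl (b j) (b l); rewrite -{1}e1 -{1}e2 !mem_last.
  move=> /(_ isT isT); apply: contraNneq => /subr0_eq ->.
  by rewrite /near_pt !subrr normr0 andbb; lra.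
pose M k j l := winding (b j) (a k) (g k l).
pose m k := M k 0 1 (+) M k 0 2 (+) M k 1 0 (+) M k 1 2 (+) M k 2 0 (+) M k 2 1.
have mP i k : i != k -> m k = ~~ m i.
  (* The terms of [winding_square] are sorted by whether they depend on [l], on [j] or on both; the
     constant one is put with [l]. *)
  move=> ik; apply: (@xor_offdiagonal
    (fun l => winding (a i) (a k) (g k l) (+) upper (a i - b l) (+) upper (a i - a k))
    (fun j => winding (a k) (a i) (g i j) (+) upper (b j - a k))
    (fun j l => upper (b j - b l))).
    by move=> j l jl; rewrite -opprB upperN // bb.
  move=> j l jl; have [[pij eij] [pkl ekl]] := (gP i j, gP k l).
  have /= := winding_square pij pkl (far i j k l ik jl); rewrite eij ekl /M.
  move/(canRL (addKb _)) => ->.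
  move: (winding _ _ (g k l)) (winding (a k) _ (g i j)) (winding (b l) _ (g i j)).
  move: (upper (a i - a k)) (upper (b j - a k)) (upper (a i - b l)) (upper (b j - b l)).
  by do 7!case.
have := (mP 0 1 isT, mP 1 2 isT, mP 0 2 isT); move: (m 0) (m 1) (m 2).
by do 3!case; case; case.
Qed.

End Crossings.

From mathcomp Require Import all_classical all_reals all_analysis.
Import numFieldNormedType.Exports.

(** * Discrete chains and separation of compact sets *)

Section Chains.
Local Open Scope classical_set_scope.
Local Open Scope ring_scope.
Variable R : realType.
Implicit Types (S T : set (R * R)) (e : R) (a b x z : R * R).

Lemma ball_near_pt e x z : ball x e z -> near_pt e x z.
Proof. by case=> /ltW h1 /ltW h2; apply/andP. Qed.

Lemma near_pt_nbhs e x : 0 < e -> \forall z \near x, near_pt e x z.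
Proof.
move=> e0; apply: filterS (nbhsx_ballx x e e0) => z; exact: ball_near_pt.
Qed.

Lemma nbhs_near_pt x (A : set (R * R)) : nbhs x A ->
  exists2 e, 0 < e & forall z, near_pt e x z -> A z.
Proof.
move=> /nbhs_ballP[e /= e0 eA]; exists (e / 2); first by rewrite divr_gt0.
move=> z /andP[h1 h2]; apply: eA; split; rewrite /ball /=.
  by apply: le_lt_trans h1 _; lra.
by apply: le_lt_trans h2 _; lra.
Qed.

Lemma near_ptW e e' a b : e <= e' -> near_pt e a b -> near_pt e' a b.
Proof. by move=> h /andP[h1 h2]; apply/andP; split; lra. Qed.

Lemma near_pt_trans e e' a b x : near_pt e a b -> near_pt e' b x -> near_pt (e + e') a x.
Proof.
move=> /andP[h1 h2] /andP[h3 h4]; apply/andP; split.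
  by rewrite (le_trans (ler_distD b.1 _ _)) // lerD.
by rewrite (le_trans (ler_distD b.2 _ _)) // lerD.
Qed.

(** A discrete substitute for paths: any two points of a connected set are chained for every
    [e > 0]. *)
Definition chained S e a b :=
  exists p, [/\ path (near_pt e) a p, last a p = b & forall z, z \in a :: p -> S z].

Lemma chained1 S e a b : S a -> S b -> near_pt e a b -> chained S e a b.
Proof.
move=> Sa Sb ab; exists [:: b]; split=> //=; first by rewrite ab.
by move=> z; rewrite !inE => /orP[] /eqP->.
Qed.

Lemma chained_trans S e b a z : chained S e a b -> chained S e b z -> chained S e a z.
Proof.
move=> [p [ap pb pS]] [q [bq qz qS]]; exists (p ++ q); split.
- by rewrite cat_path ap pb.
- by rewrite last_cat pb.
- move=> x; rewrite -cat_cons mem_cat => /orP[/pS//|xq].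
  by apply: qS; rewrite inE xq orbT.
Qed.

Lemma chained_sub S T e a b : S `<=` T -> chained S e a b -> chained T e a b.
Proof. by move=> ST [p [? ? pS]]; exists p; split=> // z /pS/ST. Qed.

(** Local invariance makes the points of [A] satisfying [P] both relatively open and relatively
    closed. *)
Lemma connected_invariant (T : topologicalType) (A : set T) (P : T -> Prop) (s t : T) :
  connected A -> A s -> A t ->
  (forall u, A u -> \forall v \near u, A v -> (P u <-> P v)) -> P s -> P t.
Proof.
move=> cA As At loc Ps; suff E : A `&` [set u | P u] = A by move: At; rewrite -E => -[].
apply: cA; first by exists s.
- exists ([set u | A u -> P u]^°); first exact: open_interior.
  apply/seteqP; split=> u [Au Pu]; split=> //; last by move/interior_subset: Pu; apply.
  by apply: filterS (loc u Au) => v h /h <-.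
- exists (~` [set u | A u -> ~ P u]^°); first exact/open_closedC/open_interior.
  apply/seteqP; split=> u [Au Pu]; split=> //.
    by move=> /interior_subset; apply.
  apply: contrapT => nPu; apply: Pu.
  by apply: filterS (loc u Au) => v h /h <-.
Qed.

Lemma chained_connected S e a b : connected S -> 0 < e -> S a -> S b -> chained S e a b.
Proof.
move=> cS e0 Sa Sb; apply: (connected_invariant (P := chained S e a) cS Sa Sb).
  move=> z Sz; apply: filterS (near_pt_nbhs z e0) => z' zz' Sz'.
  split=> h; apply: chained_trans h _; apply: chained1 => //.
  by rewrite near_pt_sym.
by exists [::]; split=> // z; rewrite inE => /eqP->.
Qed.

(** The box is convex: inserting midpoints halves the steps until they are at most [e]. *)
Lemma chained_box e c r a b : 0 < e -> near_pt r c a -> near_pt r c b ->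
  chained [set z | near_pt r c z] e a b.
Proof.
move=> e0.
have half n x z : near_pt r c x -> near_pt r c z -> near_pt (e * 2 ^+ n) x z ->
    chained [set z | near_pt r c z] e x z.
  elim: n x z => [|n IHn] x z xr zr; first by rewrite expr0 mulr1; apply: chained1.
  rewrite exprS mulrCA; move: (e * 2 ^+ n) IHn => d IHn /near_ptP[? ? ? ?].
  pose m : R * R := ((x.1 + z.1) / 2, (x.2 + z.2) / 2).
  have [? ? ? ?] := near_ptP xr; have [? ? ? ?] := near_ptP zr.
  apply: (@chained_trans _ _ m); apply: IHn => //;
    by apply/andP; split; rewrite /m /= ler_norml; lra.
move=> ar br; have [n nP] : exists n : nat, r + r <= e * 2 ^+ n.
  have [n hn] : exists n : nat, (r + r) / e <= n%:R.
    by exists (Num.truncn `|(r + r) / e|).+1; apply: ltW; apply: le_lt_trans (ler_norm _) _; apply: truncnS_gt.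
  exists n; rewrite mulrC -ler_pdivrMr //; apply: le_trans hn _.
  by rewrite -natrX ler_nat ltnW // ltn_expl.
apply: (half n) => //; apply: near_ptW nP _; apply: near_pt_trans br.
by rewrite near_pt_sym.
Qed.

Lemma compact_near_pt S T : compact S -> closed T -> S `&` T = set0 ->
  exists2 e, 0 < e & forall a b, S a -> T b -> ~~ near_pt e a b.
Proof.
move=> cS cT ST.
(* Compactness in near-covering form, along positive numbers tending to 0: a distance that works
   near each point of [S] becomes one that works on all of [S]. *)
have /(_ R (0^'+) (fun e a => forall b, T b -> ~~ near_pt e a b)) := (compact_near_coveringP S).1 cS.
case=> // [a Sa|].
  have : nbhs a (~` T).
    apply: open_nbhs_nbhs; split; first exact: closed_openC.
    by move=> Ta; have : (S `&` T) a by []; rewrite ST.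
  move=> /nbhs_near_pt[e e0 eT].
  have e20 : 0 < e / 2 by rewrite divr_gt0.
  exists ([set z | near_pt (e / 2) a z], [set d | d < e / 2]) => /=.
    by split; [exact: near_pt_nbhs | exact: nbhs_right_lt].
  move=> [z d] /= [az de] b Tb; apply/negP => zb; apply: (eT b) => //.
  by apply: near_ptW (near_pt_trans az zb); lra.
move=> e /= e0 h.
by exists (e / 2); [rewrite divr_gt0 | move=> a b Sa Tb; apply: (h (e / 2)); rewrite //= ?sub0r ?normrN ?gtr0_norm ?divr_gt0 //; lra].
Qed.

Lemma common_bound (I : finType) (Q : I -> R -> Prop) :
  (forall i e e', e' <= e -> Q i e -> Q i e') ->
  (forall i, exists2 e, 0 < e & Q i e) -> exists2 e, 0 < e & forall i, Q i e.
Proof.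
move=> mono Qe; suff [e e0 h] : exists2 e, 0 < e & forall i, i \in enum I -> Q i e.
  by exists e => // i; apply: h; rewrite mem_enum.
elim: (enum I) => [|i s [e e0 IH]]; first by exists 1.
have [e' e'0 Qi] := Qe i; exists (Num.min e e'); first by rewrite lt_min e0.
move=> j; rewrite inE => /orP[/eqP->|/IH]; last by apply: mono; rewrite ge_min lexx.
by apply: mono Qi; rewrite ge_min lexx orbT.
Qed.

End Chains.

(** * Plane drawings with all vertices on one face *)

Section DrawingK23.
Local Open Scope classical_set_scope.
Local Open Scope ring_scope.
Variables (R : realType) (G : sgraph) (pos : G -> R * R) (arc : G -> G -> R -> R * R).
Hypothesis drawing : plane_drawing pos arc.
Implicit Types (U W : {set G}).

Definition subdrawing U : set (R * R) :=
  [set z | exists p : G * G, [/\ p.1 \in U, p.2 \in U &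
     z = pos p.1 \/ adj p.1 p.2 /\ (arc p.1 p.2 @` `[0, 1]) z]].

Lemma arc_compact u v : adj u v -> compact (arc u v @` `[0, 1]).
Proof.
move=> uv; apply: continuous_compact (arc_cont drawing uv) _.
exact: segment_compact.
Qed.

Lemma arc_connected u v : adj u v -> connected (arc u v @` `[0, 1]).
Proof.
move=> uv; apply: connected_continuous_connected (arc_cont drawing uv).
exact: segment_connected.
Qed.

Lemma subdrawing_compact U : compact (subdrawing U).
Proof.
pose K (p : G * G) : set (R * R) := if (p.1 \in U) && (p.2 \in U)
  then pos p.1 |` (if adj p.1 p.2 then arc p.1 p.2 @` `[0, 1] else set0) else set0.
have -> : subdrawing U = \big[setU/set0]_(p <- enum {: G * G}) K p.
  rewrite -bigcup_seq; apply/seteqP; split=> z.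
    move=> [p [p1 p2 zp]]; exists p; first by rewrite /= mem_enum.
    by rewrite /K p1 p2 /=; case: zp => [->|[-> ?]]; [left|right].
  move=> [p _]; rewrite /K; case: andP => [[p1 p2] [->|]|//].
    by exists p; split=> //; left.
  by case: ifP => // p12 zp; exists p; split=> //; right.
apply: bigsetU_compact => p _; rewrite /K; case: ifP => _; last exact: compact0.
apply: compactU; first exact: compact_set1.
by case: ifP => [/arc_compact//|_]; apply: compact0.
Qed.

Lemma subdrawing_closed U : closed (subdrawing U).
Proof.
apply: compact_closed; last exact: subdrawing_compact.
exact: norm_hausdorff.
Qed.

Lemma subdrawingT U z : subdrawing U z -> drawing_points pos arc z.
Proof.
move=> [p [_ _ [->|[p12 zp]]]]; first by left; exists p.1.
by right; exists p.1, p.2.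
Qed.

Lemma drawing_pointsE : drawing_points pos arc = subdrawing [set: G]%SET.
Proof.
apply/seteqP; split=> z; last exact: subdrawingT.
case=> [[v _ <-]|[u [v [uv zuv]]]].
  by exists (v, v); split; rewrite ?inE //; left.
by exists (u, v); split; rewrite ?inE //; right.
Qed.

Lemma subdrawing_cases U z : subdrawing U z -> (exists2 v, v \in U & z = pos v) \/
  exists u v, [/\ u \in U, v \in U, adj u v & (arc u v @` `]0, 1[) z].
Proof.
move=> [[u v] /= [uU vU [->|[uv [t + <-]]]]]; first by left; exists u.
rewrite /= in_itv /= => /andP[t0 t1].
have [->|tn0] := eqVneq t 0; first by left; exists u; rewrite ?(arc_src drawing).
have [->|tn1] := eqVneq t 1; first by left; exists v; rewrite ?(arc_tgt drawing).
right; exists u, v; split=> //; exists t => //=.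
by rewrite in_itv /= !lt_neqAle t0 t1 tn1 eq_sym tn0.
Qed.

Lemma subdrawing_disjoint U W : {in U, forall v, v \notin W} -> subdrawing U `&` subdrawing W = set0.
Proof.
move=> dUW; have nUW v : v \in U -> v \in W -> False by move=> /dUW /negP.
apply/seteqP; split=> z // -[/subdrawing_cases zU /subdrawing_cases zW].
case: zU => [[u uU zu]|[u [u' [uU uU' uu' zu]]]]; case: zW => [[w wW zw]|[w [w' [wW wW' ww' zw]]]].
- apply: (nUW u uU); rewrite (_ : u = w) //; apply: (pos_inj drawing).
  by rewrite -zu.
- by apply: (arc_vertex drawing (w := u) ww'); rewrite -zu.
- by apply: (arc_vertex drawing (w := w) uu'); rewrite -zw.
- have := arc_disjoint drawing uu' ww'.
  move=> /(_ _ _)/= h; have : (arc u u' @` `]0, 1[ `&` arc w w' @` `]0, 1[) z by [].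
  by rewrite h // => -[? ?]; subst; [apply: (nUW w) | apply: (nUW w')].
Qed.

Lemma subdrawing_chained U a b e : 0 < e -> a \in U ->
  connect [rel u v : G | [&& u \in U, v \in U & adj u v]] a b ->
  chained (subdrawing U) e (pos a) (pos b).
Proof.
move=> e0 aU /connectP[p + ->]; elim: p a aU => [|v p IHp] a aU /=.
  move=> _; exists [::]; split=> // z; rewrite inE => /eqP->.
  by exists (a, a); split=> //; left.
move=> /andP[/and3P[_ vU av] vp]; apply: chained_trans (IHp v vU vp).
apply: (@chained_sub _ (arc a v @` `[0, 1])).
  by move=> z zav; exists (a, v); split=> //; right.
apply: chained_connected => //; first exact: arc_connected.
  by exists 0; rewrite ?(arc_src drawing) //= in_itv /= lexx ler01.
by exists 1; rewrite ?(arc_tgt drawing) //= in_itv /= lexx ler01.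
Qed.

Definition away (r : R) : set (R * R) :=
  [set z | forall d, drawing_points pos arc d -> ~~ near_pt r z d].

(* A face is open and connected, so any two of its points can be joined at
   positive distance from the drawing. *)
Lemma face_chained x q : (~` drawing_points pos arc) x ->
  connected_component (~` drawing_points pos arc) x q ->
  exists2 r, 0 < r & forall e, 0 < e -> chained (away r) e x q.
Proof.
set D := drawing_points pos arc; set F := connected_component _ x => Dx Fq.
have sep z : (~` D) z -> exists2 r, 0 < r & forall z', near_pt r z z' -> away r z'.
  move=> Dz; have : nbhs z (~` D).
    apply: open_nbhs_nbhs; split=> //; apply: closed_openC.
    by rewrite /D drawing_pointsE; apply: subdrawing_closed.
  move=> /nbhs_near_pt[r r0 rD]; exists (r / 2); first by rewrite divr_gt0.
  move=> z' zz' d Dd; apply/negP => z'd; apply: (rD d) => //.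
  by apply: near_ptW (near_pt_trans zz' z'd); lra.
have near_refl (r : R) z : 0 < r -> near_pt r z z.
  by move=> r0; rewrite /near_pt !subrr normr0 ltW.
apply: (connected_invariant (A := F)
  (P := fun z => exists2 r, 0 < r & forall e, 0 < e -> chained (away r) e x z) _ _ Fq).
- exact: component_connected.
- exact: connected_component_refl.
- move=> z Fz; have [r r0 rz] := sep z (connected_component_sub Fz).
  apply: filterS (near_pt_nbhs z r0) => z' zz' _.
  have ext y y' : near_pt r z y -> near_pt r z y' ->
      (exists2 r, 0 < r & forall e, 0 < e -> chained (away r) e x y) ->
      exists2 r, 0 < r & forall e, 0 < e -> chained (away r) e x y'.
    move=> zy zy' [r' r'0 h]; exists (Num.min r r'); first by rewrite lt_min r0.
    move=> e e0; apply: chained_trans (chained_sub _ (h e e0)) _.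
      move=> t ht d Dd; apply: contra (ht d Dd); apply: near_ptW.
      by rewrite ge_min lexx orbT.
    apply: chained_sub _ (chained_box e0 zy zy') => t /= /rz ht d Dd.
    by apply: contra (ht d Dd); apply: near_ptW; rewrite ge_min lexx.
  by split; apply: ext => //; apply: near_refl.
- have [r r0 rx] := sep x Dx; exists r => // e e0; exists [::]; split=> // z.
  by rewrite inE => /eqP->; apply: rx; apply: near_refl.
Qed.

(** Three common neighbours [w j] would be joined to [y], to the connected set [S] and, being limits
    of points of the face, to a point [x] of the face. Fine chains along these nine connections
    contradict [no_K33_chains]. *)
Lemma drawing_no_K23 F : face pos arc F -> (forall v, closure F (pos v)) -> no_K23 G.
Proof.
move=> [x Dx FE] clF y S yS connS; rewrite leqNgt; apply/negP => /card_geqP[s [us ss sS]].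
pose w (j : 'I_3) := nth y s j.
have wI : injective w.
  by move=> i j /eqP; rewrite nth_uniq ?ss // => /eqP /val_inj.
have wP j : [/\ w j \notin S, adj y (w j) & exists2 z, z \in S & adj (w j) z].
  have := sS (w j); rewrite mem_nth ?ss // inE => /(_ isT)/and3P[? ? /existsP[z /andP[? ?]]].
  by split=> //; exists z.
have [c cS _] := (let: And3 _ _ h := wP ord0 in h).
have wS j : (w j \in S) = false by case: (wP j) => /negbTE.
have wy j : w j != y.
  by case: (wP j) => _ yw _; apply: contraTneq yw => ->; rewrite adj_irrefl.
have ww (j l : 'I_3) : j != l -> w l != w j by apply: contraNneq => /wI ->.
(* One [r] serves all pairs of disjoint vertex sets, as there are finitely many. *)
have [r r0 sep] : exists2 r, 0 < r & forall p : {set G} * {set G}, {in p.1, forall v, v \notin p.2} ->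
    forall a b, subdrawing p.1 a -> subdrawing p.2 b -> ~~ near_pt r a b.
  apply: common_bound => [p e e' ee' h /h {}h a b pa pb|p].
    by apply: contra (h a b pa pb); apply: near_ptW.
  have [dp|ndp] := pselect {in p.1, forall v, v \notin p.2}; last by exists 1.
  have [e e0 h] := compact_near_pt (@subdrawing_compact p.1) (@subdrawing_closed p.2)
    (subdrawing_disjoint dp).
  by exists e.
have r20 : 0 < r / 2 by rewrite divr_gt0.
have qP j : exists q, F q /\ near_pt (r / 2) (pos (w j)) q.
  by have [q [Fq wq]] := clF (w j) _ (near_pt_nbhs _ r20); exists q.
have [q {}qP] := fin_all_exists qP.
have [t t0 tq] : exists2 t, 0 < t & forall j : 'I_3, forall e, 0 < e -> chained (away t) e x (q j).
  apply: common_bound => [j e e' ee' h d d0|j].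
    apply: chained_sub _ (h d d0) => z zD u Du; apply: contra (zD u Du).
    exact: near_ptW.
  by apply: face_chained => //; rewrite -FE; case: (qP j).
(* The 4 gives [2 * e <= r / 2]: a point in the box of radius [r / 2] around [w l] is not within
   [2 * e] of anything that is further than [r] from [w l]. *)
pose e := Num.min r t / 4.
have e0 : 0 < e by rewrite divr_gt0 // lt_min r0.
have [er et] : 2 * e <= r / 2 /\ 2 * e <= t.
  have : Num.min r t <= r by rewrite ge_min lexx.
  have : Num.min r t <= t by rewrite ge_min lexx orbT.
  by rewrite /e; split; lra.
(* The side opposite to the [w j]: [y], a vertex [c] standing for the contracted set [S], and the
   point [x]. *)
pose a (i : 'I_3) := match val i with 0%N => pos y | 1%N => pos c | _ => x end.
pose P (i j : 'I_3) : {set G} := if val i is 0%N then [set y; w j]%SET else (w j |: S)%SET.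
pose T (i j : 'I_3) : set (R * R) := match val i with
  | 0%N | 1%N => subdrawing (P i j)
  | _ => away t `|` [set z | near_pt (r / 2) (pos (w j)) z] end.
have gE (ij : 'I_3 * 'I_3) : exists p, [/\ path (near_pt e) (a ij.1) p,
    last (a ij.1) p = pos (w ij.2) & forall z, z \in a ij.1 :: p -> T ij.1 ij.2 z].
  case: ij => i j /=; rewrite -/(chained (T i j) e (a i) (pos (w j))).
  have [_ yw [z zS wz]] := wP j.
  case: i => [[|[|[|//]]] hi]; rewrite /a /T /P /=.
  - by apply: subdrawing_chained; rewrite ?inE ?eqxx // connect1 //= !inE !eqxx orbT.
  - apply: subdrawing_chained => //; first by rewrite !inE cS orbT.
    apply: connect_trans (_ : connect _ z _); last first.
      by apply: connect1; rewrite /= !inE zS eqxx orbT adj_sym.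
    apply: connect_sub (connS c z cS zS) => u v /= /and3P[uS vS uv].
    by apply: connect1; rewrite /= !inE uS vS !orbT.
  (* From [x] through the face to [q j], then inside the box around [w j]. *)
  - apply: (@chained_trans _ _ _ (q j)).
      by apply: chained_sub _ (tq j e e0) => ?; left.
    have near_w : near_pt (r / 2) (pos (w j)) (pos (w j)).
      by rewrite /near_pt !subrr normr0 ltW.
    by apply: chained_sub _ (chained_box e0 (proj2 (qP j)) near_w) => ?; right.
have [g gP] := fin_all_exists gE.
have Tdraw (i j : 'I_3) u : (i < 2)%N -> T i j u -> subdrawing (P i j) u.
  by case: i => [[|[|]]].
have Pdis (i k j l : 'I_3) : (i < k < 2)%N -> j != l -> {in P i j, forall v, v \notin P k l}.
  rewrite /P; case: i k => [[|[|[|//]]] ?] [[|[|[|//]]] ?] //= _ jl v.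
  rewrite !inE => /orP[]/eqP->; rewrite negb_or; first by rewrite eq_sym wy yS.
  by rewrite wS eq_sym ww.
have Pw (i j l : 'I_3) : j != l -> w j \notin P i l.
  rewrite /P => jl; case: i => [[|i] ?] /=; rewrite !inE negb_or.
    by rewrite wy eq_sym ww.
  by rewrite wS eq_sym ww.
have Tfar (i k j l : 'I_3) : (i < k)%N -> j != l ->
    forall u v, T i j u -> T k l v -> ~~ near_pt (2 * e) u v.
  move=> ik jl u v uT; have [k2|k2] := ltnP k 2.
    move=> /(Tdraw _ _ _ k2) vT; have {}uT := Tdraw _ _ _ (ltn_trans ik k2) uT.
    have ikb : (i < k < 2)%N by rewrite ik.
    apply: contra (sep (P i j, P k l) (Pdis _ _ _ _ ikb jl) u v uT vT).
    by apply: near_ptW; lra.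
  have {}uT : subdrawing (P i j) u.
    by apply: Tdraw => //; rewrite (leq_trans ik) // -ltnS ltn_ord.
  have -> : T k l = away t `|` [set z | near_pt (r / 2) (pos (w l)) z].
    by rewrite /T; case: k k2 {ik} => [[|[|]]].
  case=> [vt|wv].
    have := vt u (subdrawingT uT); rewrite near_pt_sym; apply: contra.
    exact: near_ptW.
  have lj : l != j by rewrite eq_sym.
  have wlw : subdrawing [set w l]%SET (pos (w l)).
    by exists (w l, w l); rewrite !inE eqxx; split=> //; left.
  have h : {in [set w l]%SET, forall v, v \notin P i j}.
    by move=> z; rewrite inE => /eqP->; apply: Pw.
  apply: contra (sep ([set w l]%SET, P i j) h _ _ wlw uT); rewrite near_pt_sym => vu.
  by apply: near_ptW (near_pt_trans wv vu); lra.
apply: (@no_K33_chains _ e a (fun j => pos (w j)) (fun i j => g (i, j))).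
- exact: ltW.
- by move=> i j; have [] := gP (i, j).
- move=> i j k l ik jl u v ui vk.
  have [_ _ /(_ u ui) uT] := gP (i, j); have [_ _ /(_ v vk) vT] := gP (k, l).
  case: (ltngtP i k) => [ltik|ltki|/val_inj eik]; last by rewrite eik eqxx in ik.
    exact: Tfar uT vT.
  by rewrite near_pt_sym; apply: Tfar vT uT; rewrite // eq_sym.
Qed.

End DrawingK23.

Lemma outerplanar_no_K23 (R : realType) (G : sgraph) : outerplanar R G -> no_K23 G.
Proof.
by case=> pos [arc [drawing [F [faceF _] clF]]]; apply: drawing_no_K23 faceF clF.
Qed.

(** * Arithmetic of the bound and conclusion *)

Lemma bounded_guesses_le s b n : 2 ^ 7 <= b -> s <= b -> 28 <= n ->
  let l := s * 2 ^ 7 in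
  l <= b ^ n /\ s * l ^ 6 * (s * l ^ 6).+1 * 2 ^ 3 <= b ^ n.
Proof.
move=> b7 sb n28 /=.
have b1 : 1 < b by apply: leq_trans b7.
have bn m : m <= 28 -> b ^ m <= b ^ n.
  by move=> m28; rewrite leq_exp2l // (leq_trans m28).
have lb : s * 2 ^ 7 <= b ^ 2 by rewrite -mulnn leq_mul.
split; first by apply: leq_trans lb (bn _ _).
(* With [S = s * l ^ 6], the factors [S], [S + 1] and [2 ^ 3] are at most [b ^ 13], [b ^ 14] and
   [b], whence the exponent 28. *)
have Sb : s * (s * 2 ^ 7) ^ 6 <= b ^ 13.
  by rewrite (expnD b 1 12) expn1 leq_mul // (expnM b 2 6) leq_exp2r.
move: (s * _) Sb => S Sb.
apply: leq_trans (bn 28 isT); rewrite (expnD b 27 1) leq_mul ?expn1 //.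
  rewrite (expnD b 13 14) leq_mul //; apply: leq_ltn_trans Sb _.
  by rewrite ltn_exp2l.
by apply: leq_trans b7.
Qed.

Theorem theorem3p5 (R : realType) (s : nat) (hs : 1 <= s) (G : sgraph)
    (hG : outerplanar R G) :
  HG G s <=
    (3 * (s + 1) ^ 6 + 3 * (s + 1) ^ 3 + 3)
      ^ (3 * ((s + 1) ^ 6 + (s + 1) ^ 3 + 1) ^ 2).
Proof.
have s6 : 2 ^ 6 <= (s + 1) ^ 6 by rewrite leq_exp2r // addn1.
have ss6 : s <= (s + 1) ^ 6.
  by apply: leq_trans (leq_addr 1 s) _; rewrite -{1}(expn1 (s + 1)) leq_pexp2l // addn1.
set b := 3 * _ + _ + _; set n := 3 * _ ^ 2.
have b7 : 2 ^ 7 <= b.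
  rewrite /b -addnA; apply: leq_trans (leq_addr _ _).
  by apply: leq_trans (leq_mul (leqnn 3) s6).
have sb : s <= b.
  by rewrite /b -addnA; apply: leq_trans ss6 (leq_trans (leq_pmull _ _) (leq_addr _ _)).
have n28 : 28 <= n.
  rewrite /n; apply: leq_trans (_ : 3 * (2 ^ 6) ^ 2 <= _) => //.
  by rewrite leq_mul2l /= leq_exp2r // -addnA (leq_trans s6) // leq_addr.
(* If the bound failed, [HG] itself would be a winnable number of colours large enough for
   [no_K23_not_winnable]. The graph without vertices is set apart, since [HG_winnable] excludes it;
   its [HG] is 0. *)
rewrite leqNgt; apply/negP => HGb.
have [lb Sb] := bounded_guesses_le b7 sb n28.
have G0 : 0 < #|G|.
  rewrite lt0n; apply: contraL HGb => /eqP G0; rewrite -leqNgt.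
  by rewrite /HG G0 muln0 big_mkcond big_ord1; case: ifP.
have := HG_winnable s G0.
by apply: (no_K23_not_winnable (outerplanar_no_K23 hG) hs erefl);
  [apply: leq_trans lb (ltnW HGb) | apply: leq_trans Sb (ltnW HGb)].
Qed.
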